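(* Let $A$ be a bounded normal operator on a Hilbert space and $z_0$ a simple eigenvalue of $A$ (one-dimensional eigenspace) such that $z_0\notin C:=\mathrm{cvh}(\mathrm{spec}(A)\setminus\{z_0\})$. Let $z_1\in C$ satisfy $|z_0-z_1|=\min\{|w-z_0|:w\in C\}$. Let $P$ be an orthogonal projection and $w_1\neq w_2$ two distinct eigenvalues of $PAP\restriction\mathrm{ran}\,P$. Then \[ \frac{(w_1-z_1)\cdot(z_0-z_1)}{|z_1-z_0|^2}+\frac{(w_2-z_1)\cdot(z_0-z_1)}{|z_1-z_0|^2}\le1, \] and in particular $|w_1-z_0|+|w_2-z_0|\ge|z_1-z_0|$. Consequently $PAP\restriction\mathrm{ran}\,P$ has at most one eigenvalue in $\{w:|w-z_0|<\tfrac12|z_1-z_0|\}$.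
   Context: $\mathrm{cvh}$ denotes the (closed) convex hull. For $u,v\in\mathbb{C}$, $u\cdot v=\mathrm{Re}(u\bar v)$ is the Euclidean inner product on $\mathbb{C}\cong\mathbb{R}^2$. *)

(* Defs.v *)
From HB Require Import structures.
From mathcomp Require Import all_boot all_order all_algebra.
From mathcomp Require Import complex.
From mathcomp Require Import all_classical all_reals.
Set Implicit Arguments. Unset Strict Implicit. Unset Printing Implicit Defensive.
Import Order.TTheory GRing.Theory Num.Theory.
Local Open Scope ring_scope.
Local Open Scope classical_set_scope.

Section Defs.
Variable R : realType.
Local Notation C := R[i].

Definition cabs (z : C) : R := Num.sqrt (complex.Re z ^+ 2 + complex.Im z ^+ 2).

Definition cdot (u v : C) : R := complex.Re (u * conjc v).

Definition cconvex (K : set C) : Prop :=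
  forall a b, K a -> K b -> forall t : R, 0 <= t <= 1 ->
    K (real_complex R t * a + real_complex R (1 - t) * b).
Definition cclosed (K : set C) : Prop :=
  forall z, (forall eps : R, 0 < eps -> exists2 k, K k & cabs (z - k) < eps) -> K z.

Definition cvh (S : set C) : set C :=
  [set z | forall K, cconvex K -> cclosed K -> S `<=` K -> K z].

Section Hilbert.
Variable V : lmodType C.
Variable ip : V -> V -> C.

Definition hnorm (x : V) : R := Num.sqrt (complex.Re (ip x x)).

Definition is_inner_product : Prop :=
  [/\ forall a x y z, ip (a *: x + y) z = a * ip x z + ip y z,
      forall x y, ip y x = conjc (ip x y),
      forall x, complex.Im (ip x x) = 0 /\ 0 <= complex.Re (ip x x)
    & forall x, ip x x = 0 -> x = 0].

Definition is_complete : Prop :=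
  forall u : nat -> V,
    (forall eps : R, 0 < eps -> exists N, forall m n, (N <= m)%N -> (N <= n)%N ->
        hnorm (u m - u n) < eps) ->
    exists l, forall eps : R, 0 < eps -> exists N, forall n, (N <= n)%N ->
        hnorm (u n - l) < eps.

Definition is_hilbert : Prop := is_inner_product /\ is_complete.

Definition linear_op (A : V -> V) : Prop :=
  forall (a : C) x y, A (a *: x + y) = a *: A x + A y.

Definition bounded_op (A : V -> V) : Prop :=
  linear_op A /\ exists M : R, forall x, hnorm (A x) <= M * hnorm x.

Definition normal_op (A : V -> V) : Prop :=
  exists Astar : V -> V, (forall x y, ip (A x) y = ip x (Astar y)) /\
    (forall x, A (Astar x) = Astar (A x)).

Definition spec (A : V -> V) : set C :=
  [set z | ~ exists B : V -> V, bounded_op B /\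
       (forall x, B (A x - z *: x) = x) /\ (forall x, A (B x) - z *: B x = x)].

Definition simple_eigenvalue (A : V -> V) (z0 : C) : Prop :=
  exists2 v, v != 0 & A v = z0 *: v /\
    forall x, A x = z0 *: x -> exists c : C, x = c *: v.

Definition orth_projection (P : V -> V) : Prop :=
  linear_op P /\ (forall x, P (P x) = P x) /\ (forall x y, ip (P x) y = ip x (P y)).

Definition compression_eigenvalue (P A : V -> V) (w : C) : Prop :=
  exists2 x, x != 0 & P x = x /\ P (A (P x)) = w *: x.
End Hilbert.
End Defs.

(* Main.v *)
Require Import Defs.
From HB Require Import structures.
From mathcomp Require Import all_boot all_order all_algebra.
From mathcomp Require Import complex.
From mathcomp Require Import all_classical all_reals.
From mathcomp Require Import ring lra.
Import Order.TTheory GRing.Theory Num.Theory.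
Local Open Scope ring_scope.
Local Open Scope classical_set_scope.

(** Let [e = z0 - z1] and [B = conj e (A - z1)], so that [|e|^2] is a simple
    eigenvalue of [B], with eigenvector [v], and the rest of the spectrum of [B]
    lies in [Re <= 0]. No spectral theorem is needed: commuting symmetric
    operators have joint approximate eigenvectors. Applied to the real and
    imaginary parts of [B] and to [(B - |e|^2)^* (Re B) (B - |e|^2)], this gives
    [Re <B y, y> <= 0] on the range of [B - |e|^2], which is dense in the
    orthogonal complement of [v]. Hence [Re <B x, x> <= |e|^2 |<x, v>|^2] for all
    [x], if [v] is a unit vector. Summing over an orthonormal basis of the span of
    two eigenvectors of the compression bounds the trace, by Bessel's
    inequality. *)

Set Implicit Arguments.
Unset Strict Implicit.

(** * Real inner product and squared norms *)

Section InnerProduct.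
Local Open Scope complex_scope.
Variables (R : realType) (V : lmodType R[i]) (ip : V -> V -> R[i]).
Hypothesis ipP : is_inner_product ip.

Definition rip (x y : V) : R := complex.Re (ip x y).
Definition nsq (x : V) : R := rip x x.
Definition sqabs (z : R[i]) : R := complex.Re z ^+ 2 + complex.Im z ^+ 2.

Lemma ipDl x y z : ip (x + y) z = ip x z + ip y z.
Proof. by case: ipP => h _ _ _; rewrite -[x]scale1r h mul1r scale1r. Qed.

Lemma ip0l z : ip 0 z = 0.
Proof. by apply: (addrI (ip 0 z)); rewrite -ipDl !addr0. Qed.

Lemma ipZl a x z : ip (a *: x) z = a * ip x z.
Proof. by case: ipP => h _ _ _; rewrite -[a *: x]addr0 h ip0l addr0. Qed.

Lemma ipNl x z : ip (- x) z = - ip x z.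
Proof. by rewrite -scaleN1r ipZl mulN1r. Qed.

Lemma ipBl x y z : ip (x - y) z = ip x z - ip y z.
Proof. by rewrite ipDl ipNl. Qed.

Lemma ipC x y : ip y x = conjc (ip x y).
Proof. by case: ipP. Qed.

Lemma ipDr x y z : ip z (x + y) = ip z x + ip z y.
Proof. by rewrite ipC ipDl rmorphD /= -!ipC. Qed.

Lemma ipZr a x z : ip z (a *: x) = conjc a * ip z x.
Proof. by rewrite ipC ipZl rmorphM /= -ipC. Qed.

Lemma ipNr x z : ip z (- x) = - ip z x.
Proof. by rewrite ipC ipNl rmorphN /= -ipC. Qed.

Lemma ipBr x y z : ip z (x - y) = ip z x - ip z y.
Proof. by rewrite ipDr ipNr. Qed.

Lemma ip0r z : ip z 0 = 0.
Proof. by rewrite ipC ip0l conjc0. Qed.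

Lemma ipxx x : ip x x = (nsq x)%:C.
Proof.
case: ipP => _ _ /(_ x) [h _] _; rewrite /nsq /rip.
by move: h; case: (ip x x) => a b /= ->.
Qed.

Lemma nsq_ge0 x : 0 <= nsq x.
Proof. by case: ipP => _ _ /(_ x) []. Qed.

Lemma nsq_eq0 x : nsq x = 0 -> x = 0.
Proof. by case: ipP => _ _ _ h h0; apply: h; rewrite ipxx h0. Qed.

Lemma nsq0 : nsq 0 = 0.
Proof. by rewrite /nsq /rip ip0l. Qed.

Lemma nsq_gt0 x : x != 0 -> 0 < nsq x.
Proof.
move=> x0; rewrite lt_def nsq_ge0 andbT.
by apply: contra x0 => /eqP/nsq_eq0 ->.
Qed.

Lemma ReD (a b : R[i]) : complex.Re (a + b) = complex.Re a + complex.Re b.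
Proof. by case: a; case: b. Qed.

Lemma ReN (a : R[i]) : complex.Re (- a) = - complex.Re a.
Proof. by case: a. Qed.

Lemma ReZ (t : R) (a : R[i]) : complex.Re (t%:C * a) = t * complex.Re a.
Proof. by case: a => a b /=; rewrite mul0r subr0. Qed.

Lemma sqabs_ge0 z : 0 <= sqabs z.
Proof. by rewrite /sqabs addr_ge0 ?sqr_ge0. Qed.

Lemma sqabs_eq0 z : sqabs z = 0 -> z = 0.
Proof.
case: z => a b; rewrite /sqabs /= => /eqP; rewrite paddr_eq0 ?sqr_ge0 // !sqrf_eq0.
by move=> /andP [/eqP -> /eqP ->].
Qed.

Lemma sqabsC (t : R) : sqabs t%:C = t ^+ 2.
Proof. by rewrite /sqabs /= expr0n addr0. Qed.

Lemma mul_conjc (z : R[i]) : z * conjc z = (sqabs z)%:C.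
Proof. by case: z => a b; rewrite /sqabs /=; simpc; congr (_ +i* _); ring. Qed.

Lemma ripC x y : rip x y = rip y x.
Proof. by rewrite /rip (ipC y x); case: (ip y x). Qed.

Lemma ripDl x y z : rip (x + y) z = rip x z + rip y z.
Proof. by rewrite /rip ipDl ReD. Qed.

Lemma ripNl x z : rip (- x) z = - rip x z.
Proof. by rewrite /rip ipNl ReN. Qed.

Lemma ripDr x y z : rip z (x + y) = rip z x + rip z y.
Proof. by rewrite ripC ripDl !(ripC _ z). Qed.

Lemma ripNr x z : rip z (- x) = - rip z x.
Proof. by rewrite ripC ripNl ripC. Qed.

Lemma ripZl t x z : rip (t%:C *: x) z = t * rip x z.
Proof. by rewrite /rip ipZl ReZ. Qed.

Lemma ripZr t x z : rip z (t%:C *: x) = t * rip z x.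
Proof. by rewrite ripC ripZl ripC. Qed.

Lemma nsqD x y : nsq (x + y) = nsq x + 2 * rip x y + nsq y.
Proof. by rewrite /nsq !ripDl !ripDr (ripC y x); ring. Qed.

Lemma nsqN x : nsq (- x) = nsq x.
Proof. by rewrite /nsq ripNl ripNr opprK. Qed.

Lemma nsqZ c x : nsq (c *: x) = sqabs c * nsq x.
Proof. by rewrite /nsq /rip ipZl ipZr mulrA mul_conjc ReZ. Qed.

Lemma nsqZr t x : nsq (t%:C *: x) = t ^+ 2 * nsq x.
Proof. by rewrite nsqZ sqabsC. Qed.

Lemma rip_le x y : 2 * rip x y <= nsq x + nsq y.
Proof. by have := nsq_ge0 (x - y); rewrite nsqD nsqN ripNr; lra. Qed.

Lemma rip_ge x y : - (nsq x + nsq y) <= 2 * rip x y.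
Proof. by have := nsq_ge0 (x + y); rewrite nsqD; lra. Qed.

Lemma nsqD_le x y : nsq (x + y) <= 2 * (nsq x + nsq y).
Proof. by have := rip_le x y; rewrite nsqD; lra. Qed.

Lemma nsqB_le x y : nsq (x - y) <= 2 * (nsq x + nsq y).
Proof. by rewrite -[nsq y]nsqN nsqD_le. Qed.

Lemma hnormE x : hnorm ip x = Num.sqrt (nsq x).
Proof. by []. Qed.

Lemma hnorm_sqr x : hnorm ip x ^+ 2 = nsq x.
Proof. by rewrite hnormE sqr_sqrtr ?nsq_ge0. Qed.

Lemma hnorm_lt x (e : R) : 0 < e -> (hnorm ip x < e) = (nsq x < e ^+ 2).
Proof.
by move=> e0; rewrite -hnorm_sqr ltr_pXn2r // nnegrE ?sqrtr_ge0 // ltW.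
Qed.

Section LinearOp.
Variable T : V -> V.
Hypothesis linT : linear_op T.

Lemma linopD x y : T (x + y) = T x + T y.
Proof. by rewrite -[x]scale1r linT !scale1r. Qed.

Lemma linop0 : T 0 = 0.
Proof. by apply: (addrI (T 0)); rewrite -linopD !addr0. Qed.

Lemma linopZ c x : T (c *: x) = c *: T x.
Proof. by rewrite -[c *: x]addr0 linT linop0 addr0. Qed.

Lemma linopB x y : T (x - y) = T x - T y.
Proof. by rewrite linopD -scaleN1r linopZ scaleN1r. Qed.

End LinearOp.

(** * Approximate null vectors of quadratic-like functionals *)

Definition symmetric_op (T : V -> V) := forall x y, rip (T x) y = rip x (T y).

Definition sq_bounded (T : V -> V) (k : R) :=
  0 <= k /\ forall x, nsq (T x) <= k * nsq x.

(** A weak parallelogram bound, shared by all sums of terms [nsq (T x - b x)]. Such sums express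
    closeness to a joint eigenvector, and adding one more term keeps the property, so that operators
    can be treated one after another. *)
Definition quasi_quadratic (Phi : V -> R) :=
  (forall x, 0 <= Phi x) /\
  forall s t x y,
    Phi (s%:C *: x + t%:C *: y) <= 2 * (s ^+ 2 * Phi x + t ^+ 2 * Phi y).

(** For [Phi x = nsq (T x - l x)] this says that [l] lies in the approximate point spectrum of
    [T]. *)
Definition approx_null (Phi : V -> R) :=
  forall eps : R, 0 < eps -> exists2 x, 0 < nsq x & Phi x <= eps * nsq x.

Lemma quasi_quadraticD Phi T (b : R) :
  quasi_quadratic Phi -> linear_op T ->
  quasi_quadratic (fun x => Phi x + nsq (T x - b%:C *: x)).
Proof.
move=> [P0 PD] linT; split=> [x|s t x y]; first by rewrite addr_ge0 ?nsq_ge0.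
have -> : T (s%:C *: x + t%:C *: y) - b%:C *: (s%:C *: x + t%:C *: y) =
    s%:C *: (T x - b%:C *: x) + t%:C *: (T y - b%:C *: y).
  rewrite (linopD linT) !(linopZ linT) scalerDr !scalerBr opprD addrACA.
  by rewrite !scalerA ![b%:C * _]mulrC.
have := nsqD_le (s%:C *: (T x - b%:C *: x)) (t%:C *: (T y - b%:C *: y)).
by have := PD s t x y; rewrite !nsqZr; lra.
Qed.

Lemma quasi_quadratic0 : quasi_quadratic (fun=> 0).
Proof. by split=> // s t x y; rewrite !mulr0 addr0 mulr0. Qed.

Lemma sq_bounded_shift K k (b : R) : sq_bounded K k ->
  sq_bounded (fun x => b%:C *: x - K x) (2 * (b ^+ 2 + k)).
Proof.
move=> [k0 Kk]; split; first by have := sqr_ge0 b; lra.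
by move=> x; have := nsqB_le (b%:C *: x) (K x); have := Kk x; rewrite nsqZr; lra.
Qed.

(* [b] is the largest limit of the Rayleigh quotients of [K] along approximate
   null vectors [x] of [Phi]. With [Q = b - K], the vector [x - t Q x] is again
   an approximate null vector, so its quotient cannot exceed [b] by much; this
   forces [Q x] to be small when the quotient at [x] is close to [b]. *)
Lemma approx_null_refine (Phi : V -> R) (K : V -> V) (k : R) :
  quasi_quadratic Phi -> linear_op K -> symmetric_op K -> sq_bounded K k ->
  (forall x, Phi (K x) <= k * Phi x) -> approx_null Phi ->
  exists b : R, (forall y, Phi y = 0 -> rip (K y) y <= b * nsq y) /\
    approx_null (fun x => Phi x + nsq (K x - b%:C *: x)).
Proof.
move=> [P0 PD] linK symK bK PK Pnull; have [k0 Kk] := bK.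
(* [E] holds the upper bounds of the Rayleigh quotient that are valid on some set
   [Phi x <= e * nsq x]; its infimum is the limit superior as [e] tends to 0. *)
pose E : set R := [set c | exists2 e : R, 0 < e &
  forall x, Phi x <= e * nsq x -> rip (K x) x <= c * nsq x].
have E0 : E ((k + 1) / 2).
  by exists 1 => // x _; have := rip_le (K x) x; have := Kk x; lra.
have Elb : lbound E (- ((k + 1) / 2)).
  move=> c [e e0 ec]; have [x x0 /ec cx] := Pnull e e0.
  have := rip_ge (K x) x; have := Kk x => h1 h2.
  by rewrite -(ler_pM2r x0); lra.
have infE : has_inf E by split; [exists ((k + 1) / 2) | exists (- ((k + 1) / 2))].
pose b := inf E; exists b; split.
  move=> y Py; rewrite leNgt; apply/negP => ylt.
  have y0 : 0 < nsq y.
    rewrite lt_def nsq_ge0 andbT; apply/eqP => y0; move: ylt.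
    by rewrite (nsq_eq0 y0) (linop0 linK) -/(nsq 0) nsq0 mulr0 ltxx.
  have d0 : 0 < rip (K y) y / nsq y - b by rewrite subr_gt0 ltr_pdivlMr.
  have [c [e e0 ec]] := inf_adherent d0 infE.
  rewrite -/b addrCA subrr addr0 => clt.
  have := ec y; rewrite Py mulr_ge0 ?(ltW e0) ?nsq_ge0 // => /(_ isT).
  by rewrite -ler_pdivrMr // leNgt clt.
pose q : R := 2 * (b ^+ 2 + k); pose Q x := b%:C *: x - K x.
have [q0 Qq] : sq_bounded Q q := sq_bounded_shift b bK.
have q1 : 0 < q + 1 by lra.
(* The form of [Q] drops by [2 t |Q x|^2] to first order in the move from [x] to [x - t Q x]. With
   this [t] the second-order term costs at most half of that, so a drop of [t |Q x|^2] remains. *)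
have [t t0 tq] : exists2 t : R, 0 < t & t * (q + 1) = 2.
  by exists (2 / (q + 1)); rewrite ?divr_gt0 // divfK ?gt_eqF.
have PQ x : Phi (Q x) <= q * Phi x.
  have := PD b (-1) x (K x); rewrite rmorphN1 scaleN1r -/(Q x).
  by have := PK x; rewrite /q; lra.
have Qdiff x : nsq (K x - b%:C *: x) = nsq (Q x) by rewrite -nsqN opprB.
have Krip y : rip (K y) y = b * nsq y - rip (Q y) y.
  by rewrite /Q ripDl ripNl ripZl opprB addrCA subrr addr0.
have symQ y z : rip (Q y) z = rip y (Q z).
  by rewrite /Q ripDl ripNl ripZl ripDr ripNr ripZr symK.
have QD r u v : Q (u - r%:C *: v) = Q u - r%:C *: Q v.
  rewrite /Q (linopB linK) (linopZ linK) !scalerBr !scalerA ![b%:C * _]mulrC.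
  by rewrite !opprD !opprK addrACA.
clearbody Q.
move=> eps eps0.
(* The first bound gives [nsq x <= 2 * nsq y] for [y = x - t Q x]. The second absorbs the final
   error [eta (3 + 2 t^2 q) |x|^2] in [t (eps / 2) |x|^2]. *)
pose eta := Num.min (1 / (4 * t)) (eps * t / (2 * (3 + 2 * t ^+ 2 * q))).
have tq0 : 0 <= t ^+ 2 * q by rewrite mulr_ge0 ?sqr_ge0.
have w0 : 0 < 2 * (3 + 2 * t ^+ 2 * q) by lra.
have eta0 : 0 < eta.
  by rewrite lt_min; apply/andP; split; rewrite divr_gt0 // ?mulr_gt0 ?ltr0n.
have eta1 : 4 * t * eta <= 1.
  have : eta <= 1 / (4 * t) by rewrite ge_min lexx.
  by rewrite ler_pdivlMr ?mulr_gt0 ?ltr0n //; lra.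
have eta2 : eta * (3 + 2 * t ^+ 2 * q) <= eps * t / 2.
  have : eta <= eps * t / (2 * (3 + 2 * t ^+ 2 * q)) by rewrite ge_min lexx orbT.
  by rewrite ler_pdivlMr //; lra.
have [c [e1 e10 ec] clt] := inf_adherent eta0 infE; rewrite -/b in clt.
(* Half of [eps] is reserved for [Phi x]; the second bound ensures [Phi y <= e1 * nsq y], where the
   bound [c] on the quotient applies. *)
pose e2 := Num.min (eps / 2) (e1 / (2 * (2 + 2 * t ^+ 2 * q))).
have w1 : 0 < 2 * (2 + 2 * t ^+ 2 * q) by lra.
have e20 : 0 < e2 by rewrite lt_min; apply/andP; split; rewrite divr_gt0 ?ltr0n.
have e21 : e2 <= eps / 2 by rewrite ge_min lexx.
have e22 : (2 + 2 * t ^+ 2 * q) * e2 <= e1 / 2.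
  have : e2 <= e1 / (2 * (2 + 2 * t ^+ 2 * q)) by rewrite ge_min lexx orbT.
  by rewrite ler_pdivlMr //; lra.
(* Otherwise [b - eta] would belong to [E], below its infimum. *)
have [x Px xlt] : exists2 x, Phi x <= e2 * nsq x & (b - eta) * nsq x < rip (K x) x.
  apply: contrapT => nx.
  have : E (b - eta).
    exists e2 => // x Px; rewrite leNgt; apply/negP => xlt.
    by apply: nx; exists x.
  by move=> /(ge_inf infE.2); rewrite -/b; lra.
have x0 : 0 < nsq x.
  rewrite lt_def nsq_ge0 andbT; apply/eqP => x0; move: xlt.
  by rewrite (nsq_eq0 x0) (linop0 linK) -/(nsq 0) nsq0 mulr0 ltxx.
exists x => //; rewrite Qdiff.
pose y := x - t%:C *: Q x.
have Ny : nsq y = nsq x - 2 * t * rip (Q x) x + t ^+ 2 * nsq (Q x).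
  by rewrite /y nsqD nsqN nsqZr ripNr ripZr (ripC x); ring.
have Qy : rip (Q y) y =
    rip (Q x) x - 2 * t * nsq (Q x) + t ^+ 2 * rip (Q (Q x)) (Q x).
  rewrite /y QD !ripDl !ripDr !ripNl !ripNr !ripZl !ripZr (symQ (Q x) x).
  by rewrite -/(nsq (Q x)); ring.
have QQ := rip_le (Q (Q x)) (Q x); have Q2 := Qq (Q x); have Q1 := Qq x.
rewrite Krip in xlt.
have Py : Phi y <= 2 * (Phi x + t ^+ 2 * (q * Phi x)).
  have := PD 1 (- t) x (Q x); rewrite scale1r rmorphN scaleNr -/y.
  have : t ^+ 2 * Phi (Q x) <= t ^+ 2 * (q * Phi x) by rewrite ler_wpM2l ?sqr_ge0.
  lra.
have tx : t * rip (Q x) x <= t * eta * nsq x.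
  by rewrite -mulrA ler_wpM2l ?(ltW t0) //; lra.
have tm : 0 <= t ^+ 2 * nsq (Q x) by rewrite mulr_ge0 ?sqr_ge0 ?nsq_ge0.
have etx : 4 * t * eta * nsq x <= 1 * nsq x by rewrite ler_wpM2r ?nsq_ge0.
have Ny2 : nsq x <= 2 * nsq y by rewrite Ny; lra.
have /ec : Phi y <= e1 * nsq y.
  have h1 : e1 * nsq x <= e1 * (2 * nsq y) by rewrite ler_wpM2l ?(ltW e10).
  have h2 : (2 + 2 * t ^+ 2 * q) * e2 * nsq x <= e1 / 2 * nsq x.
    by rewrite ler_wpM2r ?nsq_ge0.
  have h3 : (2 + 2 * t ^+ 2 * q) * Phi x <= (2 + 2 * t ^+ 2 * q) * (e2 * nsq x).
    by rewrite ler_wpM2l //; lra.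
  lra.
rewrite Krip => Kc.
have cy : c * nsq y <= (b + eta) * nsq y by rewrite ler_wpM2r ?nsq_ge0 ?ltW.
have Nyle : nsq y <= 2 * (nsq x + t ^+ 2 * (q * nsq x)).
  have := nsqB_le x (t%:C *: Q x); rewrite -/y nsqZr.
  have : t ^+ 2 * nsq (Q x) <= t ^+ 2 * (q * nsq x) by rewrite ler_wpM2l ?sqr_ge0.
  lra.
have etay : eta * nsq y <= eta * (2 * (nsq x + t ^+ 2 * (q * nsq x))).
  by rewrite ler_wpM2l ?(ltW eta0).
have tQQ : t ^+ 2 * (2 * rip (Q (Q x)) (Q x)) <= 2 * t * nsq (Q x).
  have -> : 2 * t * nsq (Q x) = t ^+ 2 * ((q + 1) * nsq (Q x)).
    by rewrite -tq; ring.
  by rewrite ler_wpM2l ?sqr_ge0 //; lra.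
have etax : eta * (3 + 2 * t ^+ 2 * q) * nsq x <= eps * t / 2 * nsq x.
  by rewrite ler_wpM2r ?nsq_ge0.
have tfin : t * nsq (Q x) <= t * (eps / 2 * nsq x) by lra.
rewrite (ler_pM2l t0) in tfin.
have : e2 * nsq x <= eps / 2 * nsq x by rewrite ler_wpM2r ?nsq_ge0.
lra.
Qed.

(** * Bounded operators, commutation and adjoints *)

Definition bop (T : V -> V) := linear_op T /\ exists k, sq_bounded T k.

Definition commute (X Y : V -> V) := forall x, X (Y x) = Y (X x).

Definition adjoint (X Y : V -> V) := forall x y, ip (X x) y = ip x (Y y).

Definition lincomb (c : R[i]) (X : V -> V) (d : R[i]) (Y : V -> V) : V -> V :=
  fun x => c *: X x + d *: Y x.

Lemma bop_id : bop id.
Proof. by split=> //; exists 1; split=> // x; rewrite mul1r. Qed.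

Lemma bop_lincomb c X d Y : bop X -> bop Y -> bop (lincomb c X d Y).
Proof.
move=> [lX [k [k0 Xk]]] [lY [l [l0 Yl]]]; split.
  move=> a x y; rewrite /lincomb lX lY !scalerDr !scalerA addrACA.
  by rewrite (mulrC a c) (mulrC a d).
have c0 := sqabs_ge0 c; have d0 := sqabs_ge0 d.
exists (2 * (sqabs c * k + sqabs d * l)); split.
  by rewrite mulr_ge0 // addr_ge0 // mulr_ge0.
move=> x; have := nsqD_le (c *: X x) (d *: Y x); rewrite !nsqZ.
have := ler_wpM2l c0 (Xk x); have := ler_wpM2l d0 (Yl x); rewrite /lincomb; lra.
Qed.

Lemma bop_comp X Y : bop X -> bop Y -> bop (X \o Y).
Proof.
move=> [lX [k [k0 Xk]]] [lY [l [l0 Yl]]]; split.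
  by move=> a x y /=; rewrite lY lX.
exists (k * l); split; first exact: mulr_ge0.
by move=> x /=; rewrite (le_trans (Xk _)) // -mulrA ler_wpM2l.
Qed.

Lemma commuteC X Y : commute X Y -> commute Y X.
Proof. by move=> h x; rewrite h. Qed.

Lemma commute_lincomb X c Y d Z : bop X -> commute X Y -> commute X Z ->
  commute X (lincomb c Y d Z).
Proof.
by move=> [lX _] hY hZ x; rewrite /lincomb (linopD lX) !(linopZ lX) hY hZ.
Qed.

Lemma commute_comp X Y Z : commute X Y -> commute X Z -> commute X (Y \o Z).
Proof. by move=> hY hZ x /=; rewrite hY hZ. Qed.

Lemma adjointC X Y : adjoint X Y -> adjoint Y X.
Proof. by move=> h x y; rewrite ipC -h -ipC. Qed.

Lemma adjoint_id : adjoint id id.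
Proof. by []. Qed.

Lemma adjoint_lincomb c X X' d Y Y' : adjoint X X' -> adjoint Y Y' ->
  adjoint (lincomb c X d Y) (lincomb (conjc c) X' (conjc d) Y').
Proof.
by move=> hX hY x y; rewrite /lincomb ipDl !ipZl ipDr !ipZr !conjcK hX hY.
Qed.

Lemma adjoint_symmetric X : adjoint X X -> symmetric_op X.
Proof. by move=> h x y; rewrite /rip h. Qed.

Lemma ip_inj x y : (forall z, ip z x = ip z y) -> x = y.
Proof.
move=> h; apply/eqP; rewrite -subr_eq0; apply/eqP/nsq_eq0.
by rewrite /nsq /rip ipBr h subrr.
Qed.

Lemma adjoint_linear X Y : adjoint X Y -> linear_op Y.
Proof.
move=> h a x y; apply: ip_inj => z.
by rewrite -h ipDr ipZr !h [RHS]ipDr ipZr.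
Qed.

(** Normality enters as [<Y x, Y x> = <X Y x, x> = <Y X x, x> = <X x, X x>]. *)
Lemma nsq_adjoint X Y x : adjoint X Y -> commute X Y -> nsq (Y x) = nsq (X x).
Proof.
by move=> h c; rewrite /nsq /rip -h c (adjointC h).
Qed.

Lemma bop_adjoint X Y : bop X -> adjoint X Y -> commute X Y -> bop Y.
Proof.
move=> [_ [k [k0 Xk]]] h c; split; first exact: adjoint_linear h.
by exists k; split=> // x; rewrite (nsq_adjoint x h c).
Qed.

(** * Calculus of joint approximate eigenvalues *)

(** Domination by [Psi] makes [X] act as [c] along every approximate null sequence of [Psi]. The
    relation respects linear combinations and products, so polynomial identities between operators
    pass to their joint approximate eigenvalues. *)
Definition approx_eigen (Psi : V -> R) (X : V -> V) (c : R[i]) :=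
  exists2 C : R, 0 <= C & forall x, nsq (X x - c *: x) <= C * Psi x.

Lemma approx_eigen_id Psi : (forall x, 0 <= Psi x) -> approx_eigen Psi id 1.
Proof. by move=> h; exists 0 => // x; rewrite scale1r subrr nsq0 mul0r. Qed.

Lemma approx_eigen_lincomb Psi c X s d Y t :
  approx_eigen Psi X s -> approx_eigen Psi Y t ->
  approx_eigen Psi (lincomb c X d Y) (c * s + d * t).
Proof.
move=> [C C0 hX] [D D0 hY].
have c0 := sqabs_ge0 c; have d0 := sqabs_ge0 d.
exists (2 * (sqabs c * C + sqabs d * D)).
  by rewrite mulr_ge0 // addr_ge0 // mulr_ge0.
move=> x.
have -> : lincomb c X d Y x - (c * s + d * t) *: x =
    c *: (X x - s *: x) + d *: (Y x - t *: x).
  by rewrite /lincomb scalerDl !scalerBr !scalerA opprD addrACA.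
have := nsqD_le (c *: (X x - s *: x)) (d *: (Y x - t *: x)); rewrite !nsqZ.
have := ler_wpM2l c0 (hX x); have := ler_wpM2l d0 (hY x); lra.
Qed.

Lemma approx_eigen_comp Psi X s Y t : bop X ->
  approx_eigen Psi X s -> approx_eigen Psi Y t ->
  approx_eigen Psi (X \o Y) (s * t).
Proof.
move=> [lX [k [k0 Xk]]] [C C0 hX] [D D0 hY].
have t0 := sqabs_ge0 t.
exists (2 * (k * D + sqabs t * C)).
  by rewrite mulr_ge0 // addr_ge0 // mulr_ge0.
move=> x /=.
have -> : X (Y x) - (s * t) *: x = X (Y x - t *: x) + t *: (X x - s *: x).
  by rewrite (linopB lX) (linopZ lX) scalerBr scalerA addrA subrK mulrC.
have := nsqD_le (X (Y x - t *: x)) (t *: (X x - s *: x)); rewrite !nsqZ.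
have := Xk (Y x - t *: x).
have := ler_wpM2l t0 (hX x); have := ler_wpM2l k0 (hY x); lra.
Qed.

Lemma approx_eigen_unique Psi X s t : approx_null Psi ->
  approx_eigen Psi X s -> approx_eigen Psi X t -> s = t.
Proof.
move=> nP [C C0 hs] [D D0 ht]; apply/eqP; rewrite -subr_eq0; apply/eqP/sqabs_eq0.
apply/eqP; rewrite eq_le sqabs_ge0 andbT leNgt; apply/negP => st0.
set d := sqabs (s - t) in st0.
(* Since [|(s - t) x|^2 <= 2 (C + D) Psi x], this denominator makes the right side smaller than
   [d |x|^2]; the summand 1 covers [C = D = 0]. *)
have w0 : 0 < 4 * (C + D) + 1 by lra.
have [x x0 hx] := nP (d / (4 * (C + D) + 1)) (divr_gt0 st0 w0).
have : nsq ((s - t) *: x) <= 2 * (C + D) * Psi x.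
  have -> : (s - t) *: x = (X x - t *: x) - (X x - s *: x).
    by rewrite opprB [RHS]addrC addrA subrK scalerBl.
  by have := nsqB_le (X x - t *: x) (X x - s *: x); have := hs x; have := ht x; lra.
rewrite nsqZ -/d; move: hx; rewrite mulrAC ler_pdivlMr // => hx h.
have Px0 : 0 <= Psi x.
  have : 0 < (C + D) * Psi x by have := mulr_gt0 st0 x0; lra.
  move=> h1; rewrite leNgt; apply/negP => h2; move: h1.
  by rewrite ltNge mulr_ge0_le0 ?addr_ge0 // ltW.
by have := mulr_gt0 st0 x0; lra.
Qed.

Lemma approx_eigen_null Psi X s : approx_null Psi -> approx_eigen Psi X s ->
  approx_null (fun x => nsq (X x - s *: x)).
Proof.
move=> nP [C C0 h] e e0; have w0 : 0 < C + 1 by lra.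
have [x x0 hx] := nP (e / (C + 1)) (divr_gt0 e0 w0); exists x => //.
have := h x; have := ler_wpM2l C0 hx.
have := mulr_gt0 (divr_gt0 e0 w0) x0.
have : e * nsq x = (C + 1) * (e / (C + 1) * nsq x).
  by rewrite mulrA mulrCA divff ?mulr1 // gt_eqF.
lra.
Qed.

(** An operator commuting with [X] preserves its approximate eigenvectors. This supplies the bound
    of [Phi (K x)] by [k * Phi x] required by [approx_null_refine]. *)
Lemma commute_shift_le X K k (b : R) x : linear_op K -> sq_bounded K k ->
  commute K X -> nsq (X (K x) - b%:C *: K x) <= k * nsq (X x - b%:C *: x).
Proof.
by move=> lK [_ Kk] c; rewrite -c -(linopZ lK) -(linopB lK).
Qed.

(* The joint approximate eigenvalues [(g, s, k)] of [(B - a)^* S (B - a)], [S]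
   and [K], where [B = S + i K], satisfy [g = |s + i k - a|^2 s]. *)
Lemma normal_rip_range_le0 B Bs (a : R[i]) :
  bop B -> adjoint B Bs -> commute B Bs ->
  (forall l, approx_null (fun x => nsq (B x - l *: x)) -> l != a ->
     complex.Re l <= 0) ->
  forall u, rip (B (B u - a *: u)) (B u - a *: u) <= 0.
Proof.
have le3 (p q r : R) : 0 <= p -> 0 <= q -> 0 <= r ->
    [/\ p <= 0 + p + q + r, q <= 0 + p + q + r & r <= 0 + p + q + r].
  by move=> *; split; lra.
move=> bB adB cB spB u; rewrite leNgt; apply/negP => ugt.
have bBs := bop_adjoint bB adB cB.
(* With [h = 1/2] and [m = i/2], [S] and [K] are the real and imaginary parts of [B]. *)
pose h : R[i] := (2^-1 : R)%:C; pose m : R[i] := 0 +i* 2^-1.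
pose S := lincomb h B h Bs; pose K := lincomb (- m) B m Bs.
pose B0 := lincomb 1 B (- a) id; pose Bs0 := lincomb 1 Bs (- conjc a) id.
pose G := Bs0 \o (S \o B0).
have adBs := adjointC adB.
have bS : bop S by apply: bop_lincomb.
have bK : bop K by apply: bop_lincomb.
have bB0 : bop B0 by apply: bop_lincomb => //; exact: bop_id.
have bBs0 : bop Bs0 by apply: bop_lincomb => //; exact: bop_id.
have bG : bop G by apply: bop_comp => //; apply: bop_comp.
have adS : adjoint S S.
  move=> x y; rewrite (adjoint_lincomb h h adB adBs) /lincomb /S conjc_real.
  by rewrite addrC.
have adK : adjoint K K.
  move=> x y; rewrite (adjoint_lincomb (- m) m adB adBs) /lincomb /K.
  have cm : conjc m = - m.
    have -> : - m = Complex (- 0) (- 2^-1) by [].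
    by rewrite oppr0.
  have -> : conjc (- m) = m by rewrite -cm conjcK.
  rewrite cm.
  by rewrite addrC.
have adB0 : adjoint B0 Bs0.
  move=> x y; rewrite (adjoint_lincomb 1 (- a) adB adjoint_id).
  by rewrite /Bs0 conjc1 rmorphN.
have adG : adjoint G G.
  by move=> x y; rewrite /G /= (adjointC adB0) adS -adB0.
have cBall X : X = B \/ X = Bs -> [/\ commute X B, commute X Bs & bop X].
  by case=> ->; split=> // x; rewrite cB.
have cX X : X = B \/ X = Bs -> [/\ commute X S, commute X K & commute X G].
  move=> /cBall [c1 c2 bX].
  have cS : commute X S by apply: commute_lincomb.
  split=> //; first exact: commute_lincomb.
  apply: commute_comp; first exact: commute_lincomb.
  by apply: commute_comp => //; apply: commute_lincomb.
have [cBS cBK cBG] := cX B (or_introl erefl).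
have [cBsS cBsK cBsG] := cX Bs (or_intror erefl).
have cSG : commute S G by apply/commuteC/commute_lincomb => //; exact: commuteC.
have cKG : commute K G by apply/commuteC/commute_lincomb => //; exact: commuteC.
have cKS : commute K S by apply/commuteC/commute_lincomb => //; exact: commuteC.
have [lG [kG bkG]] := bG; have [lS [kS bkS]] := bS; have [lK [kK bkK]] := bK.
have GE : rip (G u) u = rip (B (B u - a *: u)) (B u - a *: u).
  rewrite /G /= /rip (adjointC adB0).
  have -> : B0 u = B u - a *: u by rewrite /B0 /lincomb scale1r scaleNr.
  set y := B u - a *: u.
  rewrite /S /lincomb ipDl !ipZl -mulrDr ReZ ReD (adBs y y) (ipC (B y) y).
  by case: (ip (B y) y) => p q /=; lra.
have u0 : 0 < nsq u.
  apply/nsq_gt0; apply: contraTneq ugt => ->.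
  by rewrite (linop0 bB.1) scaler0 subr0 (linop0 bB.1) -/(nsq 0) nsq0 ltxx.
have n0 : approx_null (fun=> 0).
  by move=> e e0; exists u => //; rewrite mulr_ge0 ?ltW.
have n0G (x : V) : (0 : R) <= kG * 0 by rewrite mulr0.
(* For the zero functional every vector is null, so [g] bounds the Rayleigh quotient of [G] at [u];
   that quotient is positive by assumption, whence [g > 0]. *)
have [g [gle n1]] := approx_null_refine quasi_quadratic0 lG
  (adjoint_symmetric adG) bkG n0G n0.
have g0 : 0 < g.
  by rewrite -GE in ugt; have := lt_le_trans ugt (gle u erefl); rewrite pmulr_lgt0.
have q1 := quasi_quadraticD g quasi_quadratic0 lG.
have n1S x : (0 + nsq (G (S x) - g%:C *: S x)) <= kS * (0 + nsq (G x - g%:C *: x)).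
  by rewrite !add0r; apply: commute_shift_le.
have n1K x : (0 + nsq (G (K x) - g%:C *: K x)) <= kK * (0 + nsq (G x - g%:C *: x)).
  by rewrite !add0r; apply: commute_shift_le.
(* Each further refinement keeps the earlier terms in the functional, so the eigenvalues found
   become joint ones. *)
have [s [_ n2]] := approx_null_refine q1 lS (adjoint_symmetric adS) bkS n1S n1.
have q2 := quasi_quadraticD s q1 lS.
have n2K x : 0 + nsq (G (K x) - g%:C *: K x) + nsq (S (K x) - s%:C *: K x) <=
    kK * (0 + nsq (G x - g%:C *: x) + nsq (S x - s%:C *: x)).
  by rewrite mulrDr lerD //; apply: commute_shift_le.
have [k [_ n3]] := approx_null_refine q2 lK (adjoint_symmetric adK) bkK n2K n2.
set Psi := (X in approx_null X) in n3.
have Psi0 x : 0 <= Psi x by rewrite /Psi !addr_ge0 ?nsq_ge0.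
have Psile x := le3 _ _ _ (nsq_ge0 (G x - g%:C *: x))
  (nsq_ge0 (S x - s%:C *: x)) (nsq_ge0 (K x - k%:C *: x)).
have aG : approx_eigen Psi G g%:C.
  by exists 1 => // x; rewrite mul1r; case: (Psile x).
have aS : approx_eigen Psi S s%:C.
  by exists 1 => // x; rewrite mul1r; case: (Psile x).
have aK : approx_eigen Psi K k%:C.
  by exists 1 => // x; rewrite mul1r; case: (Psile x).
pose l : R[i] := s +i* k.
have aB : approx_eigen Psi B l.
  have -> : l = 1 * s%:C + (0 +i* 1) * k%:C.
    by rewrite /l; simpc.
  have -> : B = lincomb 1 S (0 +i* 1) K.
    apply/funext => x; rewrite /lincomb /S /K /lincomb scale1r !scalerDr !scalerA.
    rewrite addrACA -!scalerDl.
    have -> : h + (0 +i* 1) * - m = 1.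
      by rewrite /h /m; simpc; congr (_ +i* _); field.
    have -> : h + (0 +i* 1) * m = 0.
      by rewrite /h /m; simpc; congr (_ +i* _); field.
    by rewrite scale1r scale0r addr0.
  exact: approx_eigen_lincomb.
have aBs : approx_eigen Psi Bs (conjc l).
  have -> : conjc l = 1 * s%:C + (0 -i* 1) * k%:C.
    by rewrite /l; simpc.
  have -> : Bs = lincomb 1 S (0 -i* 1) K.
    apply/funext => x; rewrite /lincomb /S /K /lincomb scale1r !scalerDr !scalerA.
    rewrite addrACA -!scalerDl.
    have -> : h + (0 -i* 1) * - m = 0.
      by rewrite /h /m; simpc; congr (_ +i* _); field.
    have -> : h + (0 -i* 1) * m = 1.
      by rewrite /h /m; simpc; congr (_ +i* _); field.
    by rewrite scale1r scale0r add0r.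
  exact: approx_eigen_lincomb.
have a1 := approx_eigen_id Psi0.
have := approx_eigen_comp bBs0 (approx_eigen_lincomb 1 (- conjc a) aBs a1)
  (approx_eigen_comp bS aS (approx_eigen_lincomb 1 (- a) aB a1)).
(* The value of [G] computed from those of its factors must equal [g]. As [g > 0], this yields
   [l != a] and [Re l = s > 0], against the spectral hypothesis. *)
move=> /(approx_eigen_unique n3 aG); rewrite !mul1r !mulr1 mulrCA => gE.
have {}gE : g = s * sqabs (l - a).
  apply: complexI; rewrite gE rmorphM /= -mul_conjc; congr (_ * _).
  by rewrite mulrC rmorphB.
have la : l != a.
  by apply: contraTneq g0 => la; rewrite gE la subrr /sqabs /= expr0n addr0 mulr0 ltxx.
have := spB l (approx_eigen_null n3 aB) la; rewrite leNgt => /negP; apply.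
by rewrite /l /=; move: g0; rewrite gE pmulr_lgt0 // lt_def sqabs_ge0 andbT;
  apply: contra la => /eqP /sqabs_eq0 /eqP; rewrite subr_eq0.
Qed.

(** * Density of the range and the bound on the quadratic form *)

Lemma le0_small (h M : R) : (forall t, 0 < t -> h <= t * M) -> h <= 0.
Proof.
move=> hM; rewrite leNgt; apply/negP => h0.
have M0 : 0 < M by have := hM 1 ltr01; rewrite mul1r; exact: lt_le_trans.
have := hM (h / (2 * M)) (divr_gt0 h0 (mulr_gt0 (ltr0n _ 2) M0)).
rewrite mulrAC ler_pdivlMr ?mulr_gt0 // => le.
by have := mulr_gt0 h0 M0; lra.
Qed.

Lemma positive_null_sequence : exists2 del : nat -> R, (forall n, 0 < del n) &
  forall e, 0 < e -> exists N, forall n, (N <= n)%N -> del n < e.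
Proof.
exists (fun n => n.+1%:R^-1) => [n|e e0]; first by rewrite invr_gt0 ltr0n.
exists (Num.truncn e^-1) => n Nn.
rewrite invf_plt ?posrE // (lt_le_trans (truncnS_gt _)) //.
by rewrite ler_nat ltnS.
Qed.

(** A sequence [X (u n)] minimizing the distance to [x] is Cauchy; let [p] be its limit. The
    residual [r = x - p] is orthogonal to the range, so [Y r = 0], and [X r = 0] by normality. Then
    [r] is orthogonal to [x] by hypothesis and to the range, hence to itself. *)
Lemma normal_range_dense X Y x : is_complete ip ->
  bop X -> adjoint X Y -> commute X Y ->
  (forall y, X y = 0 -> ip x y = 0) ->
  forall e : R, 0 < e -> exists u, nsq (x - X u) < e.
Proof.
move=> cpl [lX _] ad cXY xker.
have [del del0 delP] := positive_null_sequence.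
pose E : set R := [set d | exists u, d = nsq (x - X u)].
have lbE : lbound E 0 by move=> _ [u ->]; exact: nsq_ge0.
have infE : has_inf E by split; [exists (nsq (x - X 0)); exists 0 | exists 0].
pose d := inf E.
have dle u : d <= nsq (x - X u) by apply: ge_inf; [exists 0 | exists u].
have /choice [u uP] : forall n : nat, exists u, nsq (x - X u) < d + del n.
  by move=> n; have [_ [v ->]] := inf_adherent (del0 n) infE; exists v.
(* Parallelogram identity, with the midpoint of [u m] and [u n] at squared distance at least [d]. *)
have par m n : nsq (X (u m) - X (u n)) <= 2 * del m + 2 * del n.
  have := dle ((2^-1 : R)%:C *: (u m + u n)).
  have -> : x - X ((2^-1 : R)%:C *: (u m + u n)) =
      (2^-1 : R)%:C *: ((x - X (u m)) + (x - X (u n))).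
    rewrite (linopZ lX) (linopD lX) addrACA -opprD scalerBr; congr (_ - _).
    have xx : x + x = (2 : R)%:C *: x by rewrite rmorphD /= scalerDl scale1r.
    by rewrite xx scalerA -rmorphM /= mulVf ?pnatr_eq0 // scale1r.
  have -> : X (u m) - X (u n) = (x - X (u n)) - (x - X (u m)).
    by rewrite opprB [RHS]addrC addrA subrK.
  move: (uP m) (uP n); move: (x - X (u m)) (x - X (u n)) => y z.
  have quarter : (2^-1 : R) ^+ 2 = 4^-1 by field.
  by rewrite nsqZr quarter !nsqD nsqN ripNr (ripC z); lra.
have [p pP] : exists p, forall e : R, 0 < e -> exists N, forall n, (N <= n)%N ->
    nsq (X (u n) - p) < e.
  have [|p pP] := cpl (fun n => X (u n)).
    move=> e e0; have [|N NP] := delP (e ^+ 2 / 4).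
      by rewrite divr_gt0 ?exprn_gt0 ?ltr0n.
    exists N => m n /NP hm /NP hn; rewrite hnorm_lt //.
    by have := par m n; lra.
  exists p => e e0; have s0 : 0 < Num.sqrt e by rewrite sqrtr_gt0.
  have [N NP] := pP _ s0; exists N => n /NP.
  by rewrite hnorm_lt // sqr_sqrtr // ltW.
pose r := x - p.
have rE n : r = (x - X (u n)) + (X (u n) - p) by rewrite addrA subrK.
have Yr : Y r = 0.
  apply: nsq_eq0; apply/eqP; rewrite eq_le nsq_ge0 andbT.
  have -> : nsq (Y r) = rip r (X (Y r)) by rewrite /nsq /rip (adjointC ad).
  set w := X (Y r).
  (* First-order optimality: [u n] is nearly minimizing, so replacing it by [u n + t Y r] gains
     almost nothing, which bounds [<r, w>] by [t |w|^2]. *)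
  apply: (@le0_small _ (nsq w)) => t t0.
  suff : 2 * t * rip r w <= 2 * t * (t * nsq w).
    by rewrite ler_pM2l // mulr_gt0.
  apply/ler_addgt0Pr => e e0.
  have [|N1 N1P] := delP (e / 2); first by rewrite divr_gt0.
  have [|N2 N2P] := pP (e / 2); first by rewrite divr_gt0.
  pose n := maxn N1 N2.
  have h1 := N1P n (leq_maxl _ _); have h2 := N2P n (leq_maxr _ _).
  have h3 := rip_le (X (u n) - p) (t%:C *: w); rewrite ripZr nsqZr in h3.
  have h4 := dle (u n + t%:C *: Y r).
  rewrite (linopD lX) (linopZ lX) -/w opprD addrA nsqD nsqN nsqZr ripNr ripZr in h4.
  have h5 := uP n.
  rewrite (rE n) ripDl; lra.
have Xr : X r = 0 by apply: nsq_eq0; rewrite -(nsq_adjoint r ad cXY) Yr nsq0.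
have r0 : r = 0.
  apply: nsq_eq0; apply/eqP; rewrite eq_le nsq_ge0 andbT; apply/ler_addgt0Pr => e e0.
  have [N /(_ N (leqnn N)) h] := pP e e0.
  have := rip_le (X (u N) - p) r.
  have -> : rip (X (u N) - p) r = nsq r.
    have xr : rip x r = 0 by rewrite /rip xker.
    have Xur : rip (X (u N)) r = 0 by rewrite /rip ad Yr ip0r.
    by rewrite ripDl Xur /nsq {3}/r [in RHS]ripDl xr.
  by rewrite add0r; lra.
move=> e e0; have [N /(_ N (leqnn N)) h] := pP e e0; exists (u N).
have -> : x - X (u N) = - (X (u N) - p) + r by rewrite opprB [RHS]addrC addrA subrK.
by rewrite r0 addr0 nsqN.
Qed.

Lemma commute_lincomb_id c d B Bs : bop B -> adjoint B Bs -> commute B Bs ->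
  commute (lincomb c B d id) (lincomb (conjc c) Bs (conjc d) id).
Proof.
move=> bB adB cB; have bBs := bop_adjoint bB adB cB.
apply: commute_lincomb => //; first by apply: bop_lincomb => //; exact: bop_id.
by apply: commuteC; apply: commute_lincomb.
Qed.

(** The kernel of [B - a] lies in the span of [v], so a vector orthogonal to [v] is a limit of
    vectors in the range of [B - a], where the inequality is known. *)
Lemma normal_rip_le0 B Bs (a : R[i]) v : is_complete ip ->
  bop B -> adjoint B Bs -> commute B Bs ->
  (forall x, B x = a *: x -> exists c : R[i], x = c *: v) ->
  (forall l, approx_null (fun x => nsq (B x - l *: x)) -> l != a ->
     complex.Re l <= 0) ->
  forall x, ip x v = 0 -> rip (B x) x <= 0.
Proof.
move=> cpl bB adB cB simple_a spB x xv.
have [lB [k [k0 Bk]]] := bB.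
have le0 := normal_rip_range_le0 bB adB cB spB.
pose B0 := lincomb 1 B (- a) id.
have B0E u : B0 u = B u - a *: u by rewrite /B0 /lincomb scale1r scaleNr.
have bB0 : bop B0 by apply: bop_lincomb => //; exact: bop_id.
have adB0 := adjoint_lincomb 1 (- a) adB adjoint_id.
have cB0 := commute_lincomb_id 1 (- a) bB adB cB.
have ker y : B0 y = 0 -> ip x y = 0.
  rewrite B0E => /eqP; rewrite subr_eq0 => /eqP /simple_a [c ->].
  by rewrite ipZr xv mulr0.
have dense := normal_range_dense cpl bB0 adB0 cB0 ker.
apply: (@le0_small _ ((1 + k) * nsq x)) => t t0.
(* For [z = x - y] with [y] in the range, the cross terms are split with weight [t]. Their share in
   [x] is the right side here; the rest is at most [(k + 1) (1 + t) |z|^2], made smaller than [e] by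
   density. *)
suff : 2 * t * rip (B x) x <= t ^+ 2 * ((1 + k) * nsq x).
  have -> : t ^+ 2 * ((1 + k) * nsq x) = t * (t * ((1 + k) * nsq x)) by ring.
  rewrite -mulrA mulrCA ler_pM2l // => h.
  have : 0 <= t * ((1 + k) * nsq x) by rewrite !mulr_ge0 ?nsq_ge0 ?addr_ge0 ?(ltW t0).
  lra.
apply/ler_addgt0Pr => e e0.
have w0 : 0 < (k + 1) * (1 + t) by apply: mulr_gt0; lra.
have [u uP] := dense (e / ((k + 1) * (1 + t))) (divr_gt0 e0 w0).
rewrite ltr_pdivlMr // B0E in uP.
have := le0 u; move: uP; set y := B u - a *: u; move=> uP yle.
pose z := x - y.
have yE : y = x - z by rewrite /z opprB addrC subrK.
rewrite yE (linopB lB) !ripDl !ripDr !ripNl !ripNr opprK in yle.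
rewrite -/z in uP; clearbody z.
have h1 := rip_le (B z) (t%:C *: x); rewrite ripZr nsqZr in h1.
have h2 := rip_le (t%:C *: B x) z; rewrite ripZl nsqZr in h2.
have h3 := rip_ge (B z) z.
have h4 := Bk z; have h5 := Bk x.
have h6 : t ^+ 2 * nsq (B x) <= t ^+ 2 * (k * nsq x) by rewrite ler_wpM2l ?sqr_ge0.
have h7 : t * nsq (B z) <= t * (k * nsq z) by rewrite ler_wpM2l ?(ltW t0).
have h8 : t * - (nsq (B z) + nsq z) <= t * (2 * rip (B z) z).
  by rewrite ler_wpM2l ?(ltW t0).
have h9 := mulr_ge0_le0 (ltW t0) yle.
lra.
Qed.

(** Split [x = y + c v] with [y] orthogonal to [v]. By normality of [B - a], [v] is an eigenvector
    of the adjoint too, so the cross terms vanish; the term in [y] is nonpositive and the one in [v]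
    is the right side. *)
Lemma normal_rip_le B Bs (a : R) v x : is_complete ip ->
  bop B -> adjoint B Bs -> commute B Bs -> v != 0 -> B v = a%:C *: v ->
  (forall x, B x = a%:C *: x -> exists c : R[i], x = c *: v) ->
  (forall l, approx_null (fun x => nsq (B x - l *: x)) -> l != a%:C ->
     complex.Re l <= 0) ->
  rip (B x) x <= a * (sqabs (ip x v) / nsq v).
Proof.
move=> cpl bB adB cB v0 Bv simple_a spB; have nv := nsq_gt0 v0.
have [lB _] := bB.
pose c := ip x v / (nsq v)%:C; pose y := x - c *: v.
have vC0 : (nsq v)%:C != 0 :> R[i].
  by apply: contraTneq nv => /complexI ->; rewrite ltxx.
have yv : ip y v = 0 by rewrite /y ipBl ipZl ipxx /c divfK ?subrr.
have vy : ip v y = 0 by rewrite ipC yv conjc0.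
have yle := normal_rip_le0 cpl bB adB cB simple_a spB yv.
have Bsv : Bs v = a%:C *: v.
  pose B0 := lincomb 1 B (- a%:C) id.
  have adB0 := adjoint_lincomb 1 (- a%:C) adB adjoint_id.
  have bB0 : bop B0 by apply: bop_lincomb => //; exact: bop_id.
  have cB0 := commute_lincomb_id 1 (- a%:C) bB adB cB.
  have := nsq_adjoint v adB0 cB0.
  rewrite {2}/lincomb Bv scale1r scaleNr subrr nsq0 => /nsq_eq0.
  have -> : conjc (- a%:C) = - a%:C by rewrite rmorphN; congr (- _); exact: conjc_real.
  by rewrite /lincomb conjc1 scale1r scaleNr => /subr0_eq.
have Byv : ip (B y) v = 0 by rewrite adB Bsv ipZr yv mulr0.
have xE : x = y + c *: v by rewrite /y subrK.
have cE : ip x v = c * (nsq v)%:C by rewrite divfK.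
clearbody y c.
have -> : rip (B x) x = rip (B y) y + a * (sqabs (ip x v) / nsq v).
  rewrite {1 2}xE (linopD lB) (linopZ lB) Bv /rip ipDl !ipDr !ipZr !ipZl Byv vy.
  rewrite !mulr0 addr0 add0r ReD; congr (_ + _).
  rewrite ipxx cE /sqabs; case: c {xE cE} => p q /=.
  by field; rewrite gt_eqF.
by rewrite gerDr.
Qed.

(** * Approximate spectrum, Bessel's inequality and the trace bound *)

Lemma bop_of_bounded A : bounded_op ip A -> bop A.
Proof.
move=> [lA [M hM]]; split=> //; exists (M ^+ 2); split; first exact: sqr_ge0.
move=> x; rewrite -!hnorm_sqr -exprMn ler_pXn2r // nnegrE ?sqrtr_ge0 //.
exact: le_trans (sqrtr_ge0 _) (hM x).
Qed.

(** A bounded inverse of [A - l] would give [|x|^2 <= k |(A - l) x|^2], impossible for approximate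
    eigenvectors. *)
Lemma approx_null_spec A l :
  approx_null (fun x => nsq (A x - l *: x)) -> spec ip A l.
Proof.
move=> nA [T [bT [TA _]]]; have [_ [k [k0 Tk]]] := bop_of_bounded bT.
have e0 : 0 < (2 * (k + 1))^-1 by rewrite invr_gt0; lra.
have [x x0 hx] := nA _ e0.
have := Tk (A x - l *: x); rewrite TA => h1.
have := ler_wpM2l k0 hx; rewrite mulrA => h2.
have : k / (2 * (k + 1)) < 1 by rewrite ltr_pdivrMr; lra.
rewrite -(ltr_pM2r x0); lra.
Qed.

Lemma sqabs_ipC x y : sqabs (ip x y) = sqabs (ip y x).
Proof. by rewrite (ipC y x) /sqabs; case: (ip y x) => p q /=; rewrite sqrrN. Qed.

Lemma nsq_sub_proj x v : x != 0 ->
  nsq (v - (ip v x / (nsq x)%:C) *: x) = nsq v - sqabs (ip x v) / nsq x.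
Proof.
move=> x0; have nx := nsq_gt0 x0; have nx0 : nsq x != 0 by rewrite gt_eqF.
set c := ip v x / _.
have xC0 : (nsq x)%:C != 0 :> R[i] by rewrite (inj_eq (@complexI R)).
have cE : ip v x = c * (nsq x)%:C by rewrite /c divfK.
rewrite sqabs_ipC cE nsqD nsqN nsqZ ripNr /rip ipZr cE; move: c {cE} => [p q].
by rewrite /sqabs /=; field.
Qed.

Lemma bessel2 x y v : x != 0 -> y != 0 -> ip x y = 0 ->
  sqabs (ip x v) / nsq x + sqabs (ip y v) / nsq y <= nsq v.
Proof.
move=> x0 y0 xy; set c := ip v x / (nsq x)%:C.
have h1 := nsq_sub_proj v x0; rewrite -/c in h1.
have := nsq_ge0 (v - c *: x - (ip (v - c *: x) y / (nsq y)%:C) *: y).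
rewrite nsq_sub_proj // h1 ipBr ipZr (ipC x y) xy conjc0 mulr0 subr0; lra.
Qed.

(* The trace of the compression of [B] to the span of the two eigenvectors is
   [w1 + w2]; it is computed in an orthogonal basis. *)
Lemma compression_trace_le B P (a : R) v w1 w2 :
  linear_op B -> orth_projection ip P -> v != 0 -> 0 <= a ->
  (forall x, rip (B x) x <= a * (sqabs (ip x v) / nsq v)) ->
  compression_eigenvalue P B w1 -> compression_eigenvalue P B w2 -> w1 != w2 ->
  complex.Re w1 + complex.Re w2 <= a.
Proof.
move=> lB [lP [_ sP]] v0 a0 hB [x1 x10 [Px1 e1]] [x2 x20 [Px2 e2]] w12.
rewrite Px1 in e1; rewrite Px2 in e2.
have n1 := nsq_gt0 x10; have nv := nsq_gt0 v0.
set c := ip x2 x1 / (nsq x1)%:C; pose y := x2 - c *: x1.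
have xC0 : (nsq x1)%:C != 0 :> R[i] by rewrite (inj_eq (@complexI R)) gt_eqF.
have yx : ip y x1 = 0 by rewrite /y ipBl ipZl ipxx /c divfK ?subrr.
have xy : ip x1 y = 0 by rewrite ipC yx conjc0.
have Py : P y = y by rewrite /y (linopB lP) (linopZ lP) Px1 Px2.
have x2E : x2 = y + c *: x1 by rewrite /y subrK.
have PBy : P (B y) = w2 *: x2 - c *: (w1 *: x1).
  by rewrite /y (linopB lB) (linopZ lB) (linopB lP) (linopZ lP) e1 e2.
(* Otherwise [x2] is a multiple of [x1] and an eigenvector for both [w1] and [w2]. *)
have y0 : y != 0.
  apply: contra w12 => /eqP y0.
  have x2c : x2 = c *: x1 by rewrite [LHS]x2E y0 add0r.
  move: PBy; rewrite y0 (linop0 lB) (linop0 lP) scalerA mulrC -scalerA -x2c.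
  rewrite -scalerBl => /esym /eqP.
  by rewrite scaler_eq0 (negbTE x20) orbF subr_eq0 eq_sym.
have ny := nsq_gt0 y0.
have r1 : rip (B x1) x1 = complex.Re w1 * nsq x1.
  by rewrite /rip -{2}Px1 -sP e1 ipZl ipxx mulrC ReZ mulrC.
(* The compression is triangular in the basis [x1], [y]: since [x1] is orthogonal to [y] and
   [<x2, y> = |y|^2], the diagonal entry at [y] is [w2]. *)
have r2 : rip (B y) y = complex.Re w2 * nsq y.
  rewrite /rip -{2}Py -sP PBy ipBl !ipZl xy !mulr0 subr0 x2E ipDl ipZl xy mulr0 addr0.
  by rewrite ipxx mulrC ReZ mulrC.
have := hB x1; rewrite r1 -ler_pdivlMr // => h1.
have := hB y; rewrite r2 -ler_pdivlMr // => h2.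
apply: le_trans (lerD h1 h2) _.
rewrite -!mulrA -mulrDr -[leRHS]mulr1 ler_wpM2l //.
have := bessel2 v x10 y0 xy.
rewrite -{1}[nsq v]mul1r -ler_pdivrMr // mulrDl !mulrA.
by rewrite -!mulrA ![(nsq v)^-1 * _]mulrC.
Qed.

End InnerProduct.

(** * Convex sets and nearest points in the plane *)

Section Plane.
Local Open Scope complex_scope.
Variable R : realType.
Implicit Types (z u w : R[i]) (S K : set R[i]).

Lemma subset_cvh S : S `<=` cvh S.
Proof. by move=> z Sz K _ _ SK; apply: SK. Qed.

Lemma cconvex_cvh S : cconvex (cvh S).
Proof.
move=> a b Sa Sb t t01 K cK clK SK.
exact: cK (Sa K cK clK SK) (Sb K cK clK SK) t t01.
Qed.

Lemma cabs_sqr z : cabs z ^+ 2 = sqabs z.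
Proof. by rewrite /cabs sqr_sqrtr // sqabs_ge0. Qed.

Lemma cabs_ge0 z : 0 <= cabs z.
Proof. exact: sqrtr_ge0. Qed.

Lemma cabsN z : cabs (- z) = cabs z.
Proof. by rewrite /cabs; case: z => p q /=; rewrite !sqrrN. Qed.

Lemma cdot_le u w : - cdot u w <= cabs u * cabs w.
Proof.
rewrite /cabs -sqrtrM ?sqabs_ge0 //.
apply: le_trans (ler_norm _) _; rewrite normrN -sqrtr_sqr ler_wsqrtr //.
case: u => p q; case: w => r s; rewrite /cdot /=.
(* Lagrange's identity: this square is the defect in the Cauchy-Schwarz inequality. *)
by have := sqr_ge0 (p * s - q * r); nra.
Qed.

(** Moving from [z1] towards [w] by a fraction [t] stays in [K], so it cannot reduce the distance to
    [z0]. Expanding the squared distance and letting [t] tend to 0 leaves the first-order term. *)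
Lemma cdot_nearest_le0 K z0 z1 w : cconvex K -> K z1 ->
  (forall u, K u -> cabs (z0 - z1) <= cabs (u - z0)) -> K w ->
  cdot (w - z1) (z0 - z1) <= 0.
Proof.
move=> cK K1 near Kw.
suff : 2 * cdot (w - z1) (z0 - z1) <= 0 by lra.
have small (t : R) : 0 < t -> t <= 1 ->
    2 * cdot (w - z1) (z0 - z1) <= t * sqabs (w - z1).
  move=> t0 t1; have t01 : 0 <= t <= 1 by rewrite ltW.
  have := near _ (cK _ _ Kw K1 t t01).
  rewrite -(@ler_pXn2r _ 2) ?nnegrE ?cabs_ge0 // !cabs_sqr.
  suff -> : sqabs (t%:C * w + (1 - t)%:C * z1 - z0) =
      sqabs (z0 - z1) - t * (2 * cdot (w - z1) (z0 - z1)) + t * (t * sqabs (w - z1)).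
    by move=> h; rewrite -(ler_pM2l t0); lra.
  case: w {Kw} => a b; case: z0 {near} => p q; case: z1 {K1} => r s.
  by rewrite /sqabs /cdot /=; ring.
apply: (@le0_small _ _ (sqabs (w - z1))) => t t0.
have [/small -> //|t1] := leP t 1.
apply: le_trans (small 1 ltr01 (lexx 1)) _.
by rewrite ler_wpM2r ?sqabs_ge0 // ltW.
Qed.

End Plane.

(** * Transfer from [B] back to [A] *)

Theorem theoremA2p3 (R : realType) (V : lmodType R[i]) (ip : V -> V -> R[i])
  (A P : V -> V) (z0 z1 : R[i]) :
  is_hilbert ip -> bounded_op ip A -> normal_op ip A ->
  simple_eigenvalue A z0 ->
  ~ cvh (spec ip A `\ z0) z0 ->
  cvh (spec ip A `\ z0) z1 ->
  (forall w, cvh (spec ip A `\ z0) w -> cabs (z0 - z1) <= cabs (w - z0)) ->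
  orth_projection ip P ->
  (forall w1 w2, compression_eigenvalue P A w1 -> compression_eigenvalue P A w2 ->
     w1 != w2 ->
     cdot (w1 - z1) (z0 - z1) / cabs (z1 - z0) ^+ 2
       + cdot (w2 - z1) (z0 - z1) / cabs (z1 - z0) ^+ 2 <= 1
     /\ cabs (z1 - z0) <= cabs (w1 - z0) + cabs (w2 - z0)) /\
  (forall w w', compression_eigenvalue P A w -> compression_eigenvalue P A w' ->
     cabs (w - z0) < cabs (z1 - z0) / 2 -> cabs (w' - z0) < cabs (z1 - z0) / 2 ->
     w = w').
Proof.
move=> [ipP cpl] /(bop_of_bounded ipP) bA [As [adA cA]] [v v0 [Av simple]] nz0 C1 near oP.
have [lP _] := oP.
pose e := z0 - z1; pose f := conjc e.
have e0 : e != 0 by rewrite subr_eq0; apply/eqP => z01; apply: nz0; rewrite {2}z01.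
have f0 : f != 0 by rewrite conjc_eq0.
have fe : f * e = real_complex R (sqabs e) by rewrite mulrC mul_conjc.
have a0 : 0 < sqabs e.
  rewrite lt_def sqabs_ge0 andbT; apply: contra e0 => /eqP h.
  by rewrite (sqabs_eq0 h).
(* The factor [f] turns the functional [cdot (w - z1) e] into the real part of [f * (w - z1)], the
   image of [w] under the affine map taking [A] to [B]. *)
pose B := lincomb f A (- (f * z1)) id.
have BE x : B x = f *: (A x - z1 *: x).
  by rewrite /B /lincomb scalerBr scaleNr scalerA.
have bB : bop ip B by apply: bop_lincomb => //; exact: bop_id.
have adB := adjoint_lincomb ipP f (- (f * z1)) adA (@adjoint_id _ _ ip).
have cB := commute_lincomb_id ipP f (- (f * z1)) bA adA cA.
have Bv : B v = real_complex R (sqabs e) *: v.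
  by rewrite BE Av -scalerBl scalerA fe.
have simpleB x : B x = real_complex R (sqabs e) *: x -> exists c : R[i], x = c *: v.
  rewrite BE -fe -scalerA => /(scalerI f0); rewrite scalerBl => /addIr.
  exact: simple.
have half w : spec ip A w -> w <> z0 -> cdot (w - z1) e <= 0.
  move=> sw wz; apply: cdot_nearest_le0 near _ => //; first exact: cconvex_cvh.
  by apply: subset_cvh; split.
have spB l : approx_null ip (fun x => nsq ip (B x - l *: x)) ->
    l != real_complex R (sqabs e) -> complex.Re l <= 0.
  move=> nB la.
  (* Inverting the affine map makes [f^-1 * l + z1] an approximate eigenvalue of [A], hence a
     spectral value. It differs from [z0], so it lies in the half-plane given by [half]. *)
  have aB : approx_eigen ip (fun x => nsq ip (B x - l *: x)) B l.
    by exists 1 => // x; rewrite mul1r.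
  have a1 := approx_eigen_id ipP (fun x => nsq_ge0 ipP (B x - l *: x)).
  have := approx_eigen_null nB (approx_eigen_lincomb ipP f^-1 z1 aB a1).
  have -> : lincomb f^-1 B z1 id = A.
    by apply/funext => x; rewrite /lincomb BE scalerA mulVf // scale1r subrK.
  move=> /(approx_null_spec ipP); rewrite mulr1 => /half.
  rewrite addrK /cdot -/f mulrAC mulVf // mul1r; apply.
  move=> /(canRL (addrK _)); rewrite -/e => h; case/negP: la.
  by rewrite -fe -h mulVKf.
have rle x := normal_rip_le ipP x cpl bB adB cB v0 Bv simpleB spB.
have compB w : compression_eigenvalue P A w -> compression_eigenvalue P B (f * (w - z1)).
  move=> [x x0 [Px hx]]; exists x => //; split=> //.
  by rewrite BE (linopZ lP) (linopB lP) (linopZ lP) hx !Px -scalerBl scalerA.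
have tr w1 w2 : compression_eigenvalue P A w1 -> compression_eigenvalue P A w2 ->
    w1 != w2 -> cdot (w1 - z1) e + cdot (w2 - z1) e <= sqabs e.
  move=> /compB c1 /compB c2 w12.
  rewrite /cdot -/f ![_ * f]mulrC.
  apply: (compression_trace_le ipP _ oP v0 (ltW a0) rle c1 c2); first by case: bB.
  by rewrite (inj_eq (mulfI f0)) (inj_eq (addIr _)).
have cE : cabs (z1 - z0) = cabs e by rewrite -cabsN opprB.
have main w1 w2 : compression_eigenvalue P A w1 -> compression_eigenvalue P A w2 ->
    w1 != w2 -> cabs e <= cabs (w1 - z0) + cabs (w2 - z0).
  move=> c1 c2 w12; have h := tr _ _ c1 c2 w12.
  have ce : 0 < cabs e by rewrite sqrtr_gt0.
  rewrite -(ler_pM2r ce) -expr2 cabs_sqr mulrDl.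
  (* Recentring at [z0] turns the trace bound into [|e|^2 <= - cdot (w1 - z0) e - cdot (w2 - z0) e];
     Cauchy-Schwarz then bounds the right side by [|e|] times the sum of distances. *)
  have dE w : cdot (w - z1) e = cdot (w - z0) e + sqabs e.
    have -> : w - z1 = (w - z0) + e by rewrite /e addrA subrK.
    by rewrite /cdot mulrDl ReD mul_conjc.
  have := cdot_le (w1 - z0) e; have := cdot_le (w2 - z0) e.
  by rewrite !dE in h; lra.
split.
  move=> w1 w2 c1 c2 w12; rewrite cE; split; last exact: main.
  by rewrite -mulrDl cabs_sqr ler_pdivrMr // mul1r; apply: tr.
move=> w w' c c'; rewrite cE => h h'; apply/eqP; apply: contraT => ww.
by have := main _ _ c c' ww; lra.
Qed.
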